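(* Let $k$ be a field, $G$ a (totally) ordered abelian group and $\mathcal{F}$ a family of well-ordered subsets of $G$. (i) If $\langle S(\mathcal{F})\rangle$ is a Hahn field, then it has the canonical second lifting property. (ii) If $\mathcal{F}_{\mathrm{fin}}\subseteq\mathcal{F}$ and $\mathcal{F}$ is closed under addition, then $\langle S(\mathcal{F})\rangle$ is a Hahn field with the canonical second lifting property.
   Context: $k((G))$ denotes the field of generalised power series: all functions $s\colon G\to k$, written $s=\sum_{g\in G}s_gt^g$, whose support $\mathrm{supp}(s)=\{g\mid s_g\neq 0\}$ is a well-ordered subset of $G$, with pointwise addition and convolution product. $k[G]$ is the subring of all $s$ with finite support and $k(G)$ its fraction field inside $k((G))$. A Hahn field is a field $K$ with $k(G)\subseteq K\subseteq k((G))$; it carries the canonical valuation $v(s)=\min\mathrm{supp}(s)$ for $s\neq 0$. $\mathcal{F}_{\mathrm{fin}}$ is the family of all finite subsets of $G$. $\mathcal{F}$ is closed under addition if $A+B=\{a+b\mid a\in A,b\in B\}\in\mathcal{F}$ for all $A,B\in\mathcal{F}$. Linear recurrence sequences: $\mathrm{LRS}(k,G)$ is the set of partial functions $r\colon G\rightharpoonup k$ with well-ordered domain $\mathrm{dom}(r)$; $r$ is non-trivial if $r(g)\neq 0$ for some $g\in\mathrm{dom}(r)$. $\langle r\rangle$ is the set of all $s\in k((G))$ with $\sum_{g\in\mathrm{dom}(r)}r(g)s_{h-g}=0$ for every $h\in G\setminus\mathrm{dom}(r)$ (a sum with finitely many non-zero terms), and $\langle R\rangle=\bigcup_{r\in R}\langle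 r\rangle$ for $R\subseteq\mathrm{LRS}(k,G)$. $S(\mathcal{F})$ is the set of all non-trivial $r\in\mathrm{LRS}(k,G)$ with $\mathrm{dom}(r)\in\mathcal{F}$. Lifting: $\mathrm{Hom}(G,k^\times)$ is the group of group homomorphisms $x\colon G\to k^\times$, $g\mapsto x^g$. For such $x$, $\rho_x\colon k((G))\to k((G))$, $\sum_gs_gt^g\mapsto\sum_gs_gx^gt^g$. $\mathrm{Int\,Aut}(K)$ is the group of field automorphisms $\sigma$ of $K$ that are valuation preserving ($v(a)=v(b)$ implies $v(\sigma(a))=v(\sigma(b))$) and induce the identity on $k$ and $G$, i.e. the coefficient of $t^0$ in $\sigma(c)$ equals $c$ for all $c\in k$, and $v(\sigma(a))=v(a)$ for all $a\in K^\times$. $K$ has the canonical second lifting property if $\rho_x|_K\in\mathrm{Int\,Aut}(K)$ for all $x\in\mathrm{Hom}(G,k^\times)$; equivalently, $\rho_x(s)\in K$ for all $s\in K$ and all such $x$. *)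

(* Defs.v *)
From HB Require Import structures.
From mathcomp Require Import all_boot all_order all_algebra.
From mathcomp Require Import boolp classical_sets functions cardinality fsbigop.
From mathcomp Require Import wochoice.

Set Implicit Arguments.
Unset Strict Implicit.
Unset Printing Implicit Defensive.

Import Order.TTheory GRing.Theory Num.Theory.
Local Open Scope classical_set_scope.
Local Open Scope ring_scope.

(* Totally ordered abelian groups: porderZmodType imposes no compatibility
   between the order and the addition. Totality is a field of this mixin because
   joining Order.Total with a zmodType conflicts with the existing hierarchy
   (missing joins below realDomainType). *)
HB.mixin Record POrderedZmodule_isTotallyOrderedGroup G
    & Num.POrderedZmodule G := {
  le_total_subdef : total (<=%R : rel G);
  leD2r_subdef : forall x y z : G, x <= y -> x + z <= y + z
}.

#[short(type="orderedZmodType")]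
HB.structure Definition OrderedZmodule :=
  { G of Num.POrderedZmodule G & POrderedZmodule_isTotallyOrderedGroup G }.

Section HahnSeries.
Variables (k : fieldType) (G : orderedZmodType).
Implicit Types (s u a b : G -> k) (K : set (G -> k)) (A B : set G).

Definition well_ordered A : Prop := wo_chain <=%R (mem A).

Definition supp s : set G := [set g | s g != 0].

(* k((G)), as a set of functions. The sum is the pointwise addition already
   available on G -> k; the product is [hmul] below, and NOT the pointwise
   product that functions into a ring also carry. *)
Definition hahn_series : set (G -> k) := [set s | well_ordered (supp s)].

(* Finitely supported sum (the sum over a set with infinitely many non-zero
   terms is 0 by convention; this does not occur on k((G))). *)
Definition hmul s u : G -> k := fun h => \sum_(g \in setT) s g * u (h - g).

(* c t^0 *)
Definition hconst (c : k) : G -> k := fun g => if g == 0 then c else 0.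

(* k[G] *)
Definition group_ring : set (G -> k) := [set s | finite_set (supp s)].

(* k(G): the s in k((G)) of the form a / b with a, b in k[G] and b <> 0. *)
Definition group_fraction_field : set (G -> k) :=
  [set s | hahn_series s /\
    exists a b, [/\ group_ring a, group_ring b, b <> 0 & hmul b s = a]].

Definition is_subfield K : Prop :=
  [/\ K (hconst 1),
      forall a b, K a -> K b -> K (a - b),
      forall a b, K a -> K b -> K (hmul a b) &
      forall a, K a -> a <> 0 -> exists2 b, K b & hmul a b = hconst 1].

Definition is_hahn_field K : Prop :=
  [/\ group_fraction_field `<=` K, K `<=` hahn_series & is_subfield K].

(* v(s) = Some (min (supp s)), with None in the role of v(0) = oo. *)
Definition hval s : option G :=
  xget None (Some @` (supp s `&` lbound (supp s))).

Definition is_field_automorphism K (sigma : (G -> k) -> (G -> k)) : Prop :=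
  [/\ set_bij K K sigma,
      sigma (hconst 1) = hconst 1,
      forall a b, K a -> K b -> sigma (a + b) = sigma a + sigma b &
      forall a b, K a -> K b -> sigma (hmul a b) = hmul (sigma a) (sigma b)].

(* Int Aut(K). An automorphism of K is given as a map on all of G -> k, of
   which only the restriction to K is constrained. *)
Definition int_aut K : set ((G -> k) -> (G -> k)) :=
  [set sigma |
    [/\ is_field_automorphism K sigma,
        forall a b, K a -> K b -> hval a = hval b ->
          hval (sigma a) = hval (sigma b),
        forall c : k, sigma (hconst c) 0 = c &
        forall a, K a -> a <> 0 -> hval (sigma a) = hval a]].

(* Hom(G, k^x) *)
Definition unit_hom : set (G -> k) :=
  [set x | (forall g, x g \is a GRing.unit) /\
           {morph x : g h / g + h >-> g * h}].

Definition rho (x : G -> k) s : G -> k := fun g => s g * x g.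

Definition canonical_second_lifting K : Prop :=
  forall x, unit_hom x -> int_aut K (rho x).

Definition dom (r : G -> option k) : set G := [set g | r g <> None].

Definition LRS : set (G -> option k) := [set r | well_ordered (dom r)].

Definition nontrivial (r : G -> option k) : Prop :=
  exists g, exists2 c, r g = Some c & c != 0.

(* <r>. On g \in dom r, [odflt 0 (r g)] is the value of r at g. *)
Definition lrs_solutions (r : G -> option k) : set (G -> k) :=
  [set s | hahn_series s /\
    forall h, ~ dom r h -> \sum_(g \in dom r) odflt 0 (r g) * s (h - g) = 0].

(* <R> *)
Definition lrs_union (R : set (G -> option k)) : set (G -> k) :=
  \bigcup_(r in R) lrs_solutions r.

(* S(F) *)
Definition lrs_family (F : set (set G)) : set (G -> option k) :=
  [set r | [/\ LRS r, nontrivial r & F (dom r)]].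

Definition closed_under_addition (F : set (set G)) : Prop :=
  forall A B, F A -> F B -> F [set a + b | a in A & b in B].

End HahnSeries.

Arguments lrs_family k {G} F.

(* Main.v *)
Require Import Defs.
From HB Require Import structures.
From mathcomp Require Import all_boot all_order all_algebra.
From mathcomp Require Import boolp classical_sets functions cardinality fsbigop.

Import Order.TTheory GRing.Theory Num.Theory.
Local Open Scope classical_set_scope.
Local Open Scope ring_scope.

(* A series s lies in <S(F)> iff q * s and q <> 0 have support in a common member
   of F for some q; as k((G)) is a field, sums, products and inverses of such
   quotients are again of this form when F is closed under addition. The map
   rho_x is multiplicative and preserves supports, so it maps the solutions of the
   recurrence r to those of the recurrence g |-> r(g) x^g, which has the same
   domain. *)

(** * Well-ordered subsets of a totally ordered abelian group *)

Section OrderedGroup.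
Context {G : orderedZmodType}.
Implicit Types (x y z : G) (A B : set G).

Lemma leG_total x y : (x <= y) || (y <= x).
Proof. exact: le_total_subdef. Qed.

Lemma ltG_nge x y : (x < y) = ~~ (y <= x).
Proof.
apply/idP/idP => [xy|nyx]; first by apply/negP => /(lt_le_trans xy); rewrite ltxx.
have /orP[xy|] := leG_total x y; last by rewrite (negbTE nyx).
by rewrite lt_neqAle xy andbT; apply: contraNneq nyx => ->.
Qed.

Lemma leG_add2r z x y : (x + z <= y + z) = (x <= y).
Proof.
apply/idP/idP; last exact: leD2r_subdef.
by move=> /(leD2r_subdef _ _ (- z)); rewrite !addrK.
Qed.

Lemma leG_add2l z x y : (z + x <= z + y) = (x <= y).
Proof. by rewrite ![z + _]addrC leG_add2r. Qed.

Lemma leG_opp2 x y : (- x <= - y) = (y <= x).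
Proof. by rewrite -(leG_add2r (x + y) (- x)) addKr [x + y]addrC addKr. Qed.

(** [wo_chain] asks for a unique minimum of every non-empty subpredicate; antisymmetry makes
    uniqueness automatic, which leaves the usual condition on subsets. *)
Lemma well_orderedP A : well_ordered A <->
  forall B, B `<=` A -> B !=set0 -> exists2 m, B m & lbound B m.
Proof.
split=> [Awo B BA [x Bx]|Amin].
  have [||m [[Bm mB] _]] := Awo (mem B).
  - by move=> y /set_mem/BA/mem_set.
  - by exists x; apply/mem_set.
  by exists m; [exact/set_mem | move=> y By; apply/mB/mem_set].
move=> B BA [x Bx]; have [||m Bm mB] := Amin [set y | y \in B].
- by move=> y /BA/set_mem.
- by exists x.
exists m; split=> [|y [By yB]]; first by split.
by apply/le_anti; rewrite mB//= yB.
Qed.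

Lemma sub_well_ordered A B : A `<=` B -> well_ordered B -> well_ordered A.
Proof.
move=> AB /well_orderedP Bwo; apply/well_orderedP => C CA.
by apply: Bwo; exact: subset_trans AB.
Qed.

Lemma well_ordered_min A : well_ordered A -> A !=set0 ->
  exists2 m, A m & lbound A m.
Proof. by move=> /well_orderedP; apply. Qed.

Lemma well_ordered_ind A (P : G -> Prop) : well_ordered A ->
  (forall x, A x -> (forall y, A y -> y < x -> P y) -> P x) ->
  forall x, A x -> P x.
Proof.
move=> /well_orderedP Awo IH x Ax; apply: contrapT => nPx.
have [||m [Am nPm] mmin] := Awo [set y | A y /\ ~ P y].
- by move=> y [].
- by exists x.
apply/nPm/IH => // y Ay ym; apply: contrapT => nPy.
by move: ym; rewrite ltG_nge mmin.
Qed.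

Lemma finite_well_ordered A : finite_set A -> well_ordered A.
Proof.
move=> Afin; apply/well_orderedP => B /sub_finite_set/(_ Afin)/finite_setP[n].
elim: n B => [|n IH] B.
  by rewrite II0 card_eq0 => /eqP-> [].
move=> /eq_cardSP[x Bx Bn] _.
have [/IH|] := pselect ((B `\ x) !=set0); last first.
  move=> /set0P/negP/negPn/eqP BX; exists x => // y By.
  have [->//|/eqP yx] := eqVneq y x.
  by suff: (B `\ x) y by rewrite BX.
move=> /(_ Bn)[m [Bm mx] mmin].
have /orP[xm|mx'] := leG_total x m.
  exists x => // y By; have [->//|/eqP yx] := eqVneq y x.
  by apply/(le_trans xm)/mmin.
by exists m => // y By; have [->//|/eqP yx] := eqVneq y x; apply: mmin.
Qed.

Lemma well_orderedU A B :
  well_ordered A -> well_ordered B -> well_ordered (A `|` B).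
Proof.
move=> /well_orderedP Awo /well_orderedP Bwo; apply/well_orderedP => C CAB [x Cx].
have [CA0|/set0P/negP/negPn/eqP CA0] := pselect ((C `&` A) !=set0); last first.
  apply: Bwo; last by exists x.
  by move=> y Cy; have [Ay|//] := CAB y Cy; suff: (C `&` A) y by rewrite CA0.
have [CB0|/set0P/negP/negPn/eqP CB0] := pselect ((C `&` B) !=set0); last first.
  apply: Awo; last by exists x.
  by move=> y Cy; have [//|By] := CAB y Cy; suff: (C `&` B) y by rewrite CB0.
have [m [Cm Am] mmin] := Awo _ (@subIsetr _ _ _) CA0.
have [n [Cn Bn] nmin] := Bwo _ (@subIsetr _ _ _) CB0.
have /orP[mn|nm] := leG_total m n.
  by exists m => // y Cy; case: (CAB y Cy) => ?; [|apply: (le_trans mn)];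
     [apply: mmin|apply: nmin].
by exists n => // y Cy; case: (CAB y Cy) => ?; [apply: (le_trans nm)|];
   [apply: mmin|apply: nmin].
Qed.

(* In a set R of pairs without minimal sum, pick (a, b) with b least: only pairs
   with first component below a can have a smaller sum, so one can recurse on
   the well-ordered set A. *)
Lemma well_orderedD A B : well_ordered A -> well_ordered B ->
  well_ordered [set a + b | a in A & b in B].
Proof.
move=> Awo Bwo.
pose good (R : set (G * G)) :=
  exists2 p, R p & forall q, R q -> p.1 + p.2 <= q.1 + q.2.
have step (R : set (G * G)) : R `<=` A `*` B -> R !=set0 ->
    (forall p, R p -> forall Q : set (G * G), Q `<=` A `*` B -> Q !=set0 ->
       (forall q, Q q -> q.1 < p.1) -> good Q) -> good R.
  move=> RAB [p0 Rp0] IH.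
  have [||_ [p Rp <-] pmin] := (well_orderedP B).1 Bwo (snd @` R).
  - by move=> _ [p /RAB[_ ?] <-].
  - by exists p0.2, p0.
  have le_p q : R q -> p.1 <= q.1 -> p.1 + p.2 <= q.1 + q.2.
    move=> Rq pq; apply: (@le_trans _ _ (q.1 + p.2)); first by rewrite leG_add2r.
    by rewrite leG_add2l pmin//; exists q.
  have [Q0|Q0] := pselect ([set q | R q /\ q.1 < p.1] !=set0); last first.
    exists p => // q Rq; apply: le_p => //; apply/negPn/negP.
    by rewrite -ltG_nge => qp; apply: Q0; exists q.
  have [||q [Rq qp] qmin] := IH _ Rp _ _ Q0.
  - by move=> q [/RAB].
  - by move=> q [].
  have /orP[qp'|pq'] := leG_total (q.1 + q.2) (p.1 + p.2).
    exists q => // r Rr; have [rp|] := boolP (r.1 < p.1); first exact: qmin.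
    by rewrite ltG_nge negbK => /(le_p _ Rr); exact: le_trans.
  exists p => // r Rr; have [rp|] := boolP (r.1 < p.1).
    by apply/(le_trans pq')/qmin.
  by rewrite ltG_nge negbK => /(le_p _ Rr).
have below a : A a -> forall Q : set (G * G), Q `<=` A `*` B -> Q !=set0 ->
    (forall q, Q q -> q.1 < a) -> good Q.
  move: a; apply: (well_ordered_ind _ _ Awo) => a Aa IH Q QAB Q0 Qa.
  apply: step => // q Qq.
  by apply: IH; [have [] := QAB _ Qq | exact: Qa].
apply/well_orderedP => C CAB [c Cc].
(* [below] only covers sets of pairs whose first components lie strictly below some element of [A];
   one more use of [step] removes this bound. *)
have [|||p [[Ap Bp] Cp] pmin] :=
    step [set p | (A `*` B) p /\ C (p.1 + p.2)].
- by move=> p [].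
- by have [a Aa [b Bb ab]] := CAB c Cc; exists (a, b); split=> //=; rewrite ab.
- by move=> p [[? ?] _]; exact: below.
exists (p.1 + p.2) => // d Cd; have [a Aa [b Bb abd]] := CAB d Cd.
by rewrite -abd; apply: (pmin (a, b)); split=> //=; rewrite abd.
Qed.

(* The elements with finitely many elements of A below them are all of A: look
   at the predecessor (a maximum) of the first exception. *)
Lemma dually_well_ordered_finite A : well_ordered A ->
  (forall B, B `<=` A -> B !=set0 -> exists2 m, B m & ubound B m) ->
  finite_set A.
Proof.
move=> Awo Amax.
have fin x : A x -> finite_set [set y | A y /\ y <= x].
  move: x; apply: (well_ordered_ind _ _ Awo) => x Ax IH.
  have [Z0|Z0] := pselect ([set y | A y /\ y < x] !=set0).
    have [|w [Aw wx] wmax] := Amax _ _ Z0; first by move=> y [].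
    apply: (@sub_finite_set _ _ ([set y | A y /\ y <= w] `|` [set x])).
      move=> y [Ay]; rewrite le_eqVlt => /orP[/eqP->|yx]; first by right.
      by left; split=> //; exact: wmax.
    by rewrite finite_setU; split; [exact: IH | exact: finite_set1].
  apply: (@sub_finite_set _ _ [set x]); last exact: finite_set1.
  move=> y [Ay]; rewrite le_eqVlt => /orP[/eqP->//|yx].
  by exfalso; apply: Z0; exists y.
have [->|/set0P A0] := eqVneq A set0; first exact: finite_set0.
have [//|m Am mmax] := Amax A _ A0.
by apply: sub_finite_set (fin m Am) => y Ay; split=> //; exact: mmax.
Qed.

(** Subtraction from [h] reverses the order, so a least element of [h - C] gives a greatest element
    of [C]: the set is well-ordered in both directions. This is what makes convolution sums on
    k((G)) finite. *)
Lemma finite_decompositions A B h : well_ordered A -> well_ordered B ->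
  finite_set [set g | A g /\ B (h - g)].
Proof.
move=> Awo Bwo; apply: dually_well_ordered_finite.
  by apply: sub_well_ordered Awo => g [].
move=> C CAB [c Cc].
have [||_ [m Cm <-] mmin] :=
    (well_orderedP B).1 Bwo [set h - g | g in C].
- by move=> _ [g /CAB[_ ?] <-].
- by exists (h - c), c.
exists m => // g Cg; have : h - m <= h - g by apply: mmin; exists g.
by rewrite leG_add2l leG_opp2.
Qed.

End OrderedGroup.

(** * The field of generalised power series *)

Section HahnSeriesField.
Context {k : fieldType} {G : orderedZmodType}.
Implicit Types (s u a b : G -> k) (g h m n : G).

Lemma hahn_seriesB s u : hahn_series s -> hahn_series u -> hahn_series (s - u).
Proof.
move=> swo uwo; apply: sub_well_ordered (well_orderedU _ _ swo uwo) => g /=.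
rewrite /supp /=; have [s0|] := eqVneq (s g) 0; last by left.
by have [u0|] := eqVneq (u g) 0; [rewrite !fctE s0 u0 subr0 eqxx | right].
Qed.

Lemma finite_supp_hahn_series s : finite_set (supp s) -> hahn_series s.
Proof. exact: finite_well_ordered. Qed.

Lemma supp_hmul s u : supp (hmul s u) `<=` [set g + h | g in supp s & h in supp u].
Proof.
move=> h hsu.
have [g _] := @fsbigN1 _ _ _ _ _ setT (fun h g => s g * u (h - g)) h hsu.
rewrite mulf_eq0 negb_or => /andP[sg ug].
by exists g => //; exists (h - g) => //; rewrite addrC subrK.
Qed.

Lemma hahn_series_hmul s u :
  hahn_series s -> hahn_series u -> hahn_series (hmul s u).
Proof.
move=> swo uwo; apply: sub_well_ordered (well_orderedD _ _ swo uwo).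
exact: supp_hmul.
Qed.

(** Splitting and exchanging sums is done over finite index sets; this trades [setT] for a set [X],
    possibly common to several products. *)
Lemma hmul_widen (X : set G) s u h :
  (forall g, s g != 0 -> u (h - g) != 0 -> X g) ->
  hmul s u h = \sum_(g \in X) s g * u (h - g).
Proof.
move=> sX; apply/esym/fsbig_widen => // g [_ nXg] /=; apply/eqP.
rewrite mulf_eq0; apply: contra_notT nXg; rewrite negb_or => /andP[].
exact: sX.
Qed.

Lemma hmulC s u : hmul s u = hmul u s.
Proof.
apply/funext => h; rewrite /hmul (reindex_fsbigT (fun g => h - g)); last first.
  by exists (fun g => h - g) => g; rewrite subKr.
by apply: eq_fsbigr => g _; rewrite subKr mulrC.
Qed.

Lemma hmulBr s u a : hahn_series s -> hahn_series u -> hahn_series a ->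
  hmul s (u - a) = hmul s u - hmul s a.
Proof.
move=> swo uwo awo; apply/funext => h; rewrite !fctE.
have Xfin := finite_decompositions _ _ h swo (well_orderedU _ _ uwo awo).
set X := [set g | _] in Xfin.
rewrite !(hmul_widen X).
- rewrite -mulN1r mulr_fsumr -fsbig_split//.
  by apply: eq_fsbigr => g _; rewrite mulN1r mulrBr.
- by move=> g sg ag; split=> //; right.
- by move=> g sg ug; split=> //; left.
move=> g sg uag; split=> //.
have [u0|] := eqVneq (u (h - g)) 0; last by left.
by right; move: uag; change (u (h - g) - a (h - g) != 0 -> a (h - g) != 0);
  rewrite u0 sub0r oppr_eq0.
Qed.

(** Both sides are the double sum of [a y * b (x - y) * s (h - x)], where [y] is the exponent taken
    from [a] and [x] the total exponent taken from [a] and [b]. It suffices to let them range over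
    the finite sets [Y] and [X], where the sums can be exchanged. *)
Lemma hmulA a b s : hahn_series a -> hahn_series b -> hahn_series s ->
  hmul a (hmul b s) = hmul (hmul a b) s.
Proof.
move=> awo bwo swo; apply/funext => h.
have Xfin := finite_decompositions _ _ h (well_orderedD _ _ awo bwo) swo.
have Yfin := finite_decompositions _ _ h awo (well_orderedD _ _ bwo swo).
set X := [set g | _] in Xfin; set Y := [set g | _] in Yfin.
rewrite (hmul_widen X (hmul a b)); last first.
  by move=> x abx sx; split=> //; exact: supp_hmul.
rewrite (hmul_widen Y a); last first.
  by move=> y ay bsy; split=> //; exact: supp_hmul.
have abY x : X x -> hmul a b x * s (h - x) =
    \sum_(y \in Y) a y * b (x - y) * s (h - x).
  move=> [_ sx]; rewrite (hmul_widen Y) ?mulr_fsuml// => y ay bxy.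
  split=> //; exists (x - y) => //; exists (h - x) => //.
  by rewrite addrC addrA subrK.
transitivity (\sum_(x \in X) \sum_(y \in Y) a y * b (x - y) * s (h - x)); last first.
  by apply: eq_fsbigr => x /set_mem/abY.
rewrite exchange_fsbig//; apply: eq_fsbigr => y /set_mem[ay _].
transitivity (a y * \sum_(x \in setT) b (x - y) * s (h - x)).
  congr (_ * _); rewrite /hmul (reindex_fsbigT (fun x => x - y)); last first.
    by exists (fun x => x + y) => x; rewrite ?addrK ?subrK.
  by apply: eq_fsbigr => x _; rewrite opprB addrA subrK.
transitivity (\sum_(x \in setT) a y * b (x - y) * s (h - x)).
  by rewrite mulr_fsumr; apply: eq_fsbigr => x _; rewrite mulrA.
apply/esym/fsbig_widen => // x [_ nXx] /=; apply/eqP.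
apply: contra_notT nXx; rewrite !mulf_eq0 !negb_or => /andP[/andP[_ bxy] sx].
by split=> //; exists y => //; exists (x - y) => //; rewrite addrC subrK.
Qed.

Lemma hmul_mul a b s u : hahn_series a -> hahn_series b -> hahn_series s ->
  hahn_series u -> hmul (hmul a b) (hmul s u) = hmul (hmul a s) (hmul b u).
Proof.
move=> awo bwo swo uwo.
rewrite -!hmulA//; try exact: hahn_series_hmul.
by rewrite (hmulA b)// (hmulA s)// (hmulC b).
Qed.

(** The term c t^g. For [g = 0] it is convertible to [hconst c], so its lemmas apply to constants
    directly. *)
Definition hmonomial g (c : k) : G -> k := fun h => if h == g then c else 0.

Lemma finite_supp_hmonomial g (c : k) : finite_set (supp (hmonomial g c)).
Proof.
apply: (@sub_finite_set _ _ [set g]); last exact: finite_set1.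
by move=> h; rewrite /supp /hmonomial /=; have [->|_] := eqVneq h g; rewrite ?eqxx.
Qed.

Lemma hmul_hmonomial g (c : k) s h : hmul s (hmonomial g c) h = s (h - g) * c.
Proof.
rewrite hmulC (hmul_widen [set g]); last first.
  by move=> x; rewrite /hmonomial; have [->|_] := eqVneq x g; rewrite ?eqxx.
by rewrite fsbig_set1 /hmonomial eqxx mulrC.
Qed.

Lemma hahn_series_hconst (c : k) : hahn_series (hconst c : G -> k).
Proof. by apply: finite_supp_hahn_series; exact: finite_supp_hmonomial. Qed.

Lemma hmulr1 s : hmul s (hconst 1) = s.
Proof. by apply/funext => h; rewrite hmul_hmonomial subr0 mulr1. Qed.

Lemma hconst1_neq0 : hconst 1 <> 0 :> (G -> k).
Proof.
move=> e; have : hconst 1 (0 : G) = 0 :> k by rewrite e.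
by rewrite /hconst eqxx => /eqP; rewrite oner_eq0.
Qed.

(** A contributing index [g] satisfies [g >= m] and [m + n - g >= n], hence [g = m]. Leading
    coefficients therefore multiply, which rules out zero divisors in k((G)). *)
Lemma hmul_lead s u m n : lbound (supp s) m -> lbound (supp u) n ->
  hmul s u (m + n) = s m * u n.
Proof.
move=> sm un; rewrite (hmul_widen [set m]) ?fsbig_set1 ?[m + n]addrC ?addrK//.
move=> g sg /un; rewrite -(leG_add2r g n) addrNK leG_add2l => gm.
by apply/le_anti; rewrite gm sm.
Qed.

Lemma supp_neq0 s : s <> 0 -> supp s !=set0.
Proof.
move=> s0; apply/set0P/eqP => supp0; apply: s0; apply/funext => g.
by apply/eqP/negPn/negP => sg; rewrite -[False]/(set0 g) -supp0.
Qed.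

Lemma hahn_series_lead s : hahn_series s -> s <> 0 ->
  exists2 m, s m != 0 & lbound (supp s) m.
Proof. by move=> swo /supp_neq0; exact: well_ordered_min. Qed.

Lemma hmul_neq0 s u : hahn_series s -> hahn_series u -> s <> 0 -> u <> 0 ->
  hmul s u <> 0.
Proof.
move=> swo uwo /hahn_series_lead[//|m sm mmin] /hahn_series_lead[//|n un nmin].
move=> su0; have : hmul s u (m + n) = 0 by rewrite su0.
by rewrite hmul_lead// => /eqP; rewrite mulf_eq0 (negbTE sm) (negbTE un).
Qed.

(* If m = v(s), the coefficient of s * u at m + h depends only on the restriction
   of u to ]-oo, h]. Hence the solutions of s * u = 1 up to m + h are unique up to
   h and glue to a series U which is a solution as far as any exists; correcting
   U at the first index where s * U and 1 differ would prolong it, so there is no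
   such index. *)
Lemma hahn_series_inverse s : hahn_series s -> s <> 0 ->
  exists2 u, hahn_series u & hmul s u = hconst 1.
Proof.
move=> swo /(hahn_series_lead _ swo)[m sm mmin].
pose approx h u := hahn_series u /\
  forall g, g <= h -> hmul s u (m + g) = hconst 1 (m + g).
have local u v h : (forall g, g <= h -> u g = v g) ->
    hmul s u (m + h) = hmul s v (m + h).
  move=> uv; apply: eq_fsbigr => g _.
  have [->|/mmin mg] := eqVneq (s g) 0; first by rewrite !mul0r.
  by rewrite uv// [m + h]addrC -addrA -[leRHS]addr0 leG_add2l
    -(leG_add2r g) addrNK add0r.
(* If [u] and [v] differed at some [g <= h], the leading index [n] of [u - v] would be at most [g],
   and the product with [s] would have a non-zero coefficient at [m + n], where both products agree
   with 1. *)
have uniq u v h : approx h u -> approx h v -> forall g, g <= h -> u g = v g.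
  move=> [uwo uP] [vwo vP] g gh; apply/eqP; rewrite -subr_eq0.
  apply/negPn/negP => uvg;
  have [|n uvn nmin] := hahn_series_lead _ (hahn_seriesB _ _ uwo vwo).
    by move=> uv0; move: uvg; rewrite -[u g - v g]/((u - v) g) uv0 eqxx.
  have ng : n <= g by apply: nmin.
  have := hmul_lead _ _ _ _ mmin nmin; rewrite hmulBr//.
  change (hmul s u (m + n) - hmul s v (m + n) = s m * (u - v) n -> False).
  rewrite uP ?vP ?(le_trans ng)// subrr => /esym/eqP.
  by rewrite mulf_eq0 (negbTE sm) (negbTE uvn).
have /boolp.choice[f fP] : forall h, exists u,
    (exists v, approx h v) -> approx h u.
  move=> h; have [[v hv]|nv] := pselect (exists v, approx h v); first by exists v.
  by exists 0 => /nv.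
(* The default 0 ensures that each point of the support of [U] admits an approximation up to that
   point. *)
pose U h : k := if `[< exists u, approx h u >] then f h h else 0.
have UP h u g : approx h u -> g <= h -> U g = u g.
  move=> hu gh; have gu : approx g u.
    by split=> [|i ig]; [exact: hu.1 | apply/hu.2/(le_trans ig)].
  rewrite /U asboolT; last by exists u.
  by apply: (uniq _ _ g) => //; apply: fP; exists u.
have Usol h u : approx h u -> hmul s U (m + h) = hconst 1 (m + h).
  by move=> hu; rewrite -hu.2//; apply: local => g; exact: UP.
have Uwo : hahn_series U.
  apply/well_orderedP => B BU [b Bb].
  have [u bu] : exists u, approx b u.
    by have := BU b Bb; rewrite /supp /U /=; case: asboolP => //; rewrite eqxx.
  (* Up to [b], [U] coincides with the single series [u], so the part of [B] up to [b] lies in the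
     well-ordered set [supp u]. *)
  have [||n [Bn nb] nmin] :=
      (well_orderedP (supp u)).1 bu.1 [set g | B g /\ g <= b].
  - by move=> g [/BU Ug gb]; rewrite /supp /= -(UP b).
  - by exists b.
  exists n => // g Bg; have /orP[gb|bg] := leG_total g b; first exact: nmin.
  exact: le_trans bg.
exists U => //; apply: contrapT => sU1.
pose d := hconst 1 - hmul s U.
have dwo : hahn_series d.
  by apply: hahn_seriesB; [exact: hahn_series_hconst | exact: hahn_series_hmul].
have [|n dn nmin] := hahn_series_lead _ dwo.
  by move=> d0; apply/sU1/esym/eqP; rewrite -subr_eq0; apply/eqP.
(* The coefficient is chosen so that [hmul s e] has value [- d n] at [n]; below [n] it vanishes, so
   [U - e] solves the equation up to and including [n]. *)
pose e : G -> k := hmonomial (n - m) (- (d n / s m)).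
have ewo : hahn_series e by apply: finite_supp_hahn_series; exact: finite_supp_hmonomial.
have : approx (n - m) (U - e).
  split=> [|g gn]; first exact: hahn_seriesB.
  rewrite hmulBr//.
  change (hmul s U (m + g) - hmul s e (m + g) = hconst 1 (m + g)).
  have dE h : hconst 1 h = d h + hmul s U h by rewrite -[d h]/(_ - _) subrK.
  rewrite dE addrC; congr (_ + _); rewrite hmul_hmonomial mulrN opprK.
  have : m + g <= n by rewrite addrC -(leG_add2r (- m)) addrK.
  rewrite le_eqVlt => /orP[/eqP mgn|mgn].
    by rewrite mgn subKr mulrC divfK.
  have -> : d (m + g) = 0.
    apply/eqP/negPn/negP => dmg; have := nmin _ dmg; apply/negP.
    by rewrite -ltG_nge.
  have [->|/mmin] := eqVneq (s (m + g - (n - m))) 0; first by rewrite mul0r.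
  rewrite -(leG_add2r (n - m)) addrNK addrC subrK => ngm.
  by move: mgn; rewrite ltG_nge ngm.
(* As an approximation up to [n - m] exists, [U] itself is correct at [n], against [d n != 0]. *)
move=> /Usol; rewrite addrC subrK => sU1n.
by move: dn; rewrite -[d n]/(_ - _) sU1n subrr eqxx.
Qed.

End HahnSeriesField.

(** * The maps [rho x] and the lifting property *)

Section Lifting.
Context {k : fieldType} {G : orderedZmodType}.
Implicit Types (s a b x : G -> k) (K : set (G -> k)).

Lemma unit_hom_neq0 x g : unit_hom x -> x g != 0.
Proof. by move=> [/(_ g)]; rewrite unitfE. Qed.

Lemma unit_hom0 x : unit_hom x -> x 0 = 1.
Proof.
move=> xhom; have [_ xD] := xhom; apply: (mulfI (unit_hom_neq0 _ 0 xhom)).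
by rewrite -xD addr0 mulr1.
Qed.

Lemma unit_homV x : unit_hom x -> unit_hom (fun g => (x g)^-1).
Proof.
by move=> [xU xD]; split=> [g|g h]; rewrite ?unitrV// xD invfM.
Qed.

Lemma supp_rho x s : unit_hom x -> supp (rho x s) = supp s.
Proof.
move=> xhom; apply/seteqP.
by split=> g; rewrite /supp /rho /= mulf_eq0 (negbTE (unit_hom_neq0 _ g xhom)) orbF.
Qed.

Lemma hval_rho x s : unit_hom x -> hval (rho x s) = hval s.
Proof. by move=> xhom; rewrite /hval supp_rho. Qed.

Lemma rho_hconst x c : unit_hom x -> rho x (hconst c) = hconst c.
Proof.
move=> xhom; apply/funext => g; rewrite /rho /hconst.
by case: eqVneq => [->|_]; rewrite ?unit_hom0 ?mulr1 ?mul0r.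
Qed.

Lemma rhoD x a b : rho x (a + b) = rho x a + rho x b.
Proof. by apply/funext => g; exact: mulrDl. Qed.

Lemma rho_hmul x a b : unit_hom x ->
  rho x (hmul a b) = hmul (rho x a) (rho x b).
Proof.
move=> [_ xD]; apply/funext => h; rewrite /rho /hmul mulr_fsuml.
apply: eq_fsbigr => g _; rewrite mulrACA -xD.
by rewrite [g + _]addrC subrK.
Qed.

Lemma rhoK x s : unit_hom x -> rho (fun g => (x g)^-1) (rho x s) = s.
Proof.
by move=> xhom; apply/funext => g; rewrite /rho mulfK// unit_hom_neq0.
Qed.

(** Closure is assumed for all homomorphisms [y] because surjectivity of [rho x] on [K] uses closure
    under the map of the inverse homomorphism. *)
Lemma rho_int_aut K x : unit_hom x ->
  (forall y, unit_hom y -> forall s, K s -> K (rho y s)) -> int_aut K (rho x).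
Proof.
move=> xhom Krho; split.
- split.
  + split=> [s|s u _ _ su|s Ks]; first exact: Krho.
      by rewrite -(rhoK x s)// su rhoK.
    exists (rho (fun g => (x g)^-1) s).
      by apply: Krho => //; exact: unit_homV.
    by apply/funext => g; rewrite /rho divfK// unit_hom_neq0.
  + exact: rho_hconst.
  + by move=> a b _ _; exact: rhoD.
  + by move=> a b _ _; exact: rho_hmul.
- by move=> a b _ _; rewrite !hval_rho.
- by move=> c; rewrite rho_hconst// /hconst eqxx.
- by move=> a _ _; exact: hval_rho.
Qed.

Lemma rho_lrs_union (F : set (set G)) x s : unit_hom x ->
  lrs_union (lrs_family k F) s -> lrs_union (lrs_family k F) (rho x s).
Proof.
move=> xhom [r [rwo [g [c rg c0]] Fr] [swo sr]].
have [_ xD] := xhom.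
pose rx g := omap (fun c => c * x g) (r g).
have drx : dom rx = dom r.
  by apply/seteqP; split=> h; rewrite /dom /rx /=; case: (r h).
exists rx; first (split; rewrite ?drx//).
  by rewrite /LRS /= drx.
  exists g; exists (c * x g); first by rewrite /rx rg.
  by rewrite mulf_neq0// unit_hom_neq0.
split; first by rewrite /hahn_series /= supp_rho.
rewrite drx => h nrh.
(* Since x^i x^(h-i) = x^h, each term is the old one scaled by the common factor [x h]. *)
transitivity ((\sum_(g \in dom r) odflt 0 (r g) * s (h - g)) * x h).
  rewrite mulr_fsuml; apply: eq_fsbigr => i _; rewrite /rx /rho.
  have -> : x h = x i * x (h - i) by rewrite -xD [i + _]addrC subrK.
  by case: (r i) => [d|] /=; rewrite ?mul0r// mulrACA.
by rewrite sr// mul0r.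
Qed.

Lemma lrs_union_canonical_second_lifting (F : set (set G)) :
  canonical_second_lifting (lrs_union (lrs_family k F)).
Proof.
by move=> x xhom; apply: rho_int_aut => // y yhom s; exact: rho_lrs_union.
Qed.

End Lifting.

(** * Solutions of recurrences as quotients, and the field they form *)

Section RecurrenceField.
Context {k : fieldType} {G : orderedZmodType} {F : set (set G)}.
Context (F_wo : forall A : set G, F A -> well_ordered A).
Implicit Types (s q : G -> k) (A B : set G).

(* Extending r by 0 off its domain to a series q, the sum in the recurrence at h
   is the coefficient of q * s at h. So s is a quotient p / q of two series
   supported in the same member of F. *)
Lemma lrs_unionP s : lrs_union (lrs_family k F) s <->
  hahn_series s /\ exists A q, [/\ F A, q <> 0, supp q `<=` A &
    supp (hmul q s) `<=` A].
Proof.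
split=> [[r [rwo [g [c rg c0]] Fr] [swo sr]]|[swo [A [q [FA q0 qA qsA]]]]].
  pose q g := odflt 0 (r g).
  have qr : supp q `<=` dom r.
    by move=> h; rewrite /supp /q /dom /=; case: (r h) => //=; rewrite eqxx.
  split=> //; exists (dom r), q; split=> //.
    move=> q0; have : q g = 0 by rewrite q0.
    by rewrite /q rg /= => /eqP; rewrite (negbTE c0).
  move=> h qsh; apply: contrapT => /sr; rewrite -[LHS](hmul_widen (dom r) q).
    by move/eqP; apply/negP.
  by move=> i qi _; exact: qr.
(* Zero values of [q] on [A] are kept: the domain must be [A] itself, since [supp q] need not belong
   to [F]. *)
pose r g := if g \in A then Some (q g) else None.
have rA : dom r = A.
  apply/seteqP; split=> g; rewrite /dom /r /=; first by case: ifP => // /set_mem.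
  by move=> /mem_set ->.
exists r.
  split; rewrite ?rA//; first by rewrite /LRS /= rA; exact: F_wo.
  have [g qg] := supp_neq0 _ q0; exists g; exists (q g) => //.
  by rewrite /r mem_set//; exact: qA.
split=> // h; rewrite rA => nAh.
transitivity (hmul q s h).
  rewrite (hmul_widen A); last by move=> g qg _; exact: qA.
  by apply: eq_fsbigr => g gA; rewrite /r gA.
by apply/eqP/negPn/negP => /qsA.
Qed.

Lemma lrs_union_hahn_field : [set A : set G | finite_set A] `<=` F ->
  closed_under_addition F -> is_hahn_field (lrs_union (lrs_family k F)).
Proof.
move=> Ffin FD.
have qwo A q : F A -> supp q `<=` A -> hahn_series q.
  by move=> /F_wo Awo qA; exact: sub_well_ordered Awo.
have fracK : @group_fraction_field k G `<=` lrs_union (lrs_family k F).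
  move=> s [swo [a [b [afin bfin b0 bs]]]]; apply/lrs_unionP; split=> //.
  exists (supp a `|` supp b), b; split=> //.
  - by apply: Ffin; rewrite /= finite_setU.
  - by rewrite bs => g; left.
have suppM q p A B : supp q `<=` A -> supp p `<=` B ->
    supp (hmul q p) `<=` [set a + b | a in A & b in B].
  move=> qA pB g /supp_hmul[a qa [b pb <-]].
  by exists a; [exact: qA|exists b; [exact: pB|]].
split=> //; first by move=> s /lrs_unionP[].
split.
- apply: fracK; split; first exact: hahn_series_hconst.
  exists (hconst 1), (hconst 1).
  by split; [exact: finite_supp_hmonomial..|exact: hconst1_neq0|exact: hmulr1].
- move=> s u /lrs_unionP[swo [A [p [FA p0 pA psA]]]].
  move=> /lrs_unionP[uwo [B [q [FB q0 qB quB]]]].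
  have [pwo qwo'] := (qwo _ _ FA pA, qwo _ _ FB qB).
  apply/lrs_unionP; split; first exact: hahn_seriesB.
  (* With the common denominator pq, the numerator of s - u is (ps)q - p(qu); in both products the
     first factor is supported in [A] and the second in [B]. *)
  exists [set a + b | a in A & b in B], (hmul p q); split.
  + exact: FD.
  + exact: hmul_neq0.
  + exact: suppM.
  rewrite hmulBr//; last exact: hahn_series_hmul.
  have -> : hmul (hmul p q) s = hmul (hmul p s) q.
    by rewrite -!hmulA// (hmulC q).
  rewrite -(hmulA p q u)//.
  move=> g; have [psq0|] := eqVneq (hmul (hmul p s) q g) 0; last first.
    by move=> psq _; exact: (suppM (hmul p s) q).
  move=> psqu; apply: (suppM p (hmul q u)) => //; move: psqu.
  change (hmul (hmul p s) q g - hmul p (hmul q u) g != 0 ->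
    hmul p (hmul q u) g != 0).
  by rewrite psq0 sub0r oppr_eq0.
- move=> s u /lrs_unionP[swo [A [p [FA p0 pA psA]]]].
  move=> /lrs_unionP[uwo [B [q [FB q0 qB quB]]]].
  have [pwo qwo'] := (qwo _ _ FA pA, qwo _ _ FB qB).
  apply/lrs_unionP; split; first exact: hahn_series_hmul.
  exists [set a + b | a in A & b in B], (hmul p q); split.
  + exact: FD.
  + exact: hmul_neq0.
  + exact: suppM.
  by rewrite hmul_mul//; exact: suppM.
- move=> s /lrs_unionP[swo [A [q [FA q0 qA qsA]]]] s0.
  have [u uwo su] := hahn_series_inverse _ swo s0.
  (* The inverse of s = (qs)/q is q/(qs): numerator and denominator trade places within the same
     [A]. *)
  exists u => //; apply/lrs_unionP; split=> //; exists A, (hmul q s); split=> //.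
    by apply: hmul_neq0 => //; exact: qwo qA.
  by rewrite -hmulA ?su ?hmulr1//; exact: qwo qA.
Qed.

End RecurrenceField.

Theorem corollary8p19 (k : fieldType) (G : orderedZmodType) (F : set (set G))
    (F_wo : forall A : set G, F A -> well_ordered A) :
  (is_hahn_field (lrs_union (lrs_family k F)) ->
     canonical_second_lifting (lrs_union (lrs_family k F))) /\
  ([set A : set G | finite_set A] `<=` F -> closed_under_addition F ->
     is_hahn_field (lrs_union (lrs_family k F)) /\
     canonical_second_lifting (lrs_union (lrs_family k F))).
Proof.
split=> [_|Ffin FD]; first exact: lrs_union_canonical_second_lifting.
split; first exact: lrs_union_hahn_field.
exact: lrs_union_canonical_second_lifting.
Qed.
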